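(* Let $\mathcal{X}$ be a finite set and let $P$ be an irreducible transition matrix on $\mathcal{X}$ with stationary distribution $\pi$ ($\pi P=\pi$), and let $\varepsilon>0$. Then $$\bar t_{\mathrm{Ces}}^{(\mathrm{TV})}(\varepsilon,P)\le\frac1{\varepsilon(1-2\varepsilon)}\,t_{\mathrm{mix}}^{(\mathrm{TV})}(\varepsilon,P).$$ Furthermore, assume that there exists $0<\theta<1$ such that $\eta^{(\mathrm{TV})}(P)\le\theta$ (i.e. $P$ is scrambling). If $\alpha\in(0,1)\cup(1,+\infty)$ and $D_\alpha(P\|\Pi)<\infty$, then $$\bar t_{\mathrm{Ces}}^{(\mathrm{TV})}(\varepsilon,P)\le\frac1\varepsilon\,\bar t_{\mathrm{mix}}^{(\mathrm{TV})}(\varepsilon,P)+\frac1{1-\theta},$$ $$\bar t_{\mathrm{Ces}}^{(D_\alpha)}(\varepsilon,P)\le\frac{D_\alpha(P\|\Pi)}{\varepsilon}\,\bar t_{\mathrm{mix}}^{(D_\alpha)}(\varepsilon,P)+\frac1{1-\theta},$$ $$\bar t_{\mathrm{Ces}}^{(R_\alpha)}(\varepsilon,P)\le\frac{1+\varepsilon}{\varepsilon}\,D_\alpha(P\|\Pi)\,\bar t_{\mathrm{mix}}^{(R_\alpha)}(\varepsilon,P)+\frac1{1-\theta}.$$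
   Context: $\Pi(x,y):=\pi(y)$ for all $x,y\in\mathcal{X}$. For transition matrices $M,L$ on $\mathcal{X}$: $\mathrm{TV}(M,L):=\frac12\sum_{x,y}\pi(x)|M(x,y)-L(x,y)|$; for a transition matrix $M$ and $\alpha\in(0,1)\cup(1,\infty)$, $D_\alpha(M\|\Pi):=\frac1{\alpha-1}\left(\sum_{x,y}\pi(x)\pi(y)\left(\frac{M(x,y)}{\pi(y)}\right)^\alpha-1\right)$ and $R_\alpha(M\|\Pi):=\frac1{\alpha-1}\ln(1+(\alpha-1)D_\alpha(M\|\Pi))$. The ergodicity (Dobrushin) coefficient is $\eta^{(\mathrm{TV})}(P):=\sup_{M\ne L}\frac{\mathrm{TV}(MP,LP)}{\mathrm{TV}(M,L)}$, the supremum over pairs of distinct transition matrices on $\mathcal{X}$. $P$ is scrambling if for all $x,y\in\mathcal{X}$ there is $z\in\mathcal{X}$ with $P(x,z)>0$ and $P(y,z)>0$. Mixing times ($t$ ranging over positive integers): $t_{\mathrm{mix}}^{(\mathrm{TV})}(\varepsilon,P):=\inf\{t>0:\max_x\frac12\sum_y|P^t(x,y)-\pi(y)|<\varepsilon\}$; $\bar t_{\mathrm{mix}}^{(\mathrm{TV})}(\varepsilon,P):=\inf\{t>0:\mathrm{TV}(P^t,\Pi)<\varepsilon\}$; $\bar t_{\mathrm{mix}}^{(D_\alpha)}(\varepsilon,P):=\inf\{t>0:D_\alpha(P^t\|\Pi)<\varepsilon\}$; $\bar t_{\mathrm{mix}}^{(R_\alpha)}(\varepsilon,P):=\inf\{t>0:R_\alpha(P^t\|\Pi)<\varepsilon\}$.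 Cesàro mixing times: $\bar t_{\mathrm{Ces}}^{(\mathrm{TV})}(\varepsilon,P):=\inf\{t>0:\mathrm{TV}(\frac1t\sum_{s=1}^tP^s,\Pi)<\varepsilon\}$, and $\bar t_{\mathrm{Ces}}^{(D_\alpha)}(\varepsilon,P)$, $\bar t_{\mathrm{Ces}}^{(R_\alpha)}(\varepsilon,P)$ are defined likewise with the conditions $D_\alpha(\frac1t\sum_{s=1}^tP^s\|\Pi)<\varepsilon$ and $R_\alpha(\frac1t\sum_{s=1}^tP^s\|\Pi)<\varepsilon$ respectively.
   Formalization: The first inequality is stated only for 0 < ε < 1/2: at ε = 1/2 the factor 1/(ε(1−2ε)) is undefined, and for ε > 1/2 it is negative while the left side is at least 1, so the claim fails (e.g. P = Π, ε = 1). *)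

(* Defs.v *)
From mathcomp Require Import all_boot all_order all_algebra.
From mathcomp Require Import all_classical all_reals all_analysis.

Set Implicit Arguments.
Unset Strict Implicit.
Unset Printing Implicit Defensive.

Import Order.TTheory GRing.Theory Num.Theory.

Local Open Scope classical_set_scope.
Local Open Scope ring_scope.

(* A finite state space with n elements is 'I_n; probability measures on it   *)
(* are row vectors and Markov kernels are square matrices.                    *)

Definition distribution (R : realType) (n : nat) (pi : 'rV[R]_n) : Prop :=
  (forall x, 0 <= pi 0 x) /\ \sum_x pi 0 x = 1.

Definition transition_matrix (R : realType) (n : nat) (P : 'M[R]_n) : Prop :=
  (forall x y, 0 <= P x y) /\ (forall x, \sum_y P x y = 1).

Definition irreducible (R : realType) (n : nat) (P : 'M[R]_n) : Prop :=
  forall x y, exists t : nat, (0 < t)%N /\ 0 < (P ^+ t) x y.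

Definition stationary (R : realType) (n : nat) (pi : 'rV[R]_n) (P : 'M[R]_n)
  : Prop := distribution pi /\ pi *m P = pi.

Definition scrambling (R : realType) (n : nat) (P : 'M[R]_n) : Prop :=
  forall x y, exists z, 0 < P x z /\ 0 < P y z.

Definition Pi_mx (R : realType) (n : nat) (pi : 'rV[R]_n) : 'M[R]_n :=
  \matrix_(x, y) pi 0 y.

Definition TV (R : realType) (n : nat) (pi : 'rV[R]_n) (M L : 'M[R]_n) : R :=
  2^-1 * \sum_x \sum_y pi 0 x * `|M x y - L x y|.

(* D_alpha(M || Pi) and R_alpha(M || Pi). All divisions are genuine when pi   *)
(* has full support, e.g. when pi is stationary for an irreducible matrix.    *)
Definition Dalpha (R : realType) (n : nat) (alpha : R) (pi : 'rV[R]_n)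
    (M : 'M[R]_n) : R :=
  (alpha - 1)^-1 *
    (\sum_x \sum_y pi 0 x * pi 0 y * (M x y / pi 0 y) `^ alpha - 1).

Definition Ralpha (R : realType) (n : nat) (alpha : R) (pi : 'rV[R]_n)
    (M : 'M[R]_n) : R :=
  (alpha - 1)^-1 * ln (1 + (alpha - 1) * Dalpha alpha pi M).

(* The supremum is taken in the extended reals; for a one-point state space   *)
(* the family is empty and the value is -oo.                                  *)
Definition eta_TV (R : realType) (n : nat) (pi : 'rV[R]_n) (P : 'M[R]_n)
  : \bar R :=
  ereal_sup [set r : \bar R | exists M L : 'M[R]_n,
    [/\ transition_matrix M, transition_matrix L, M <> L &
        r = (TV pi (M *m P) (L *m P) / TV pi M L)%:E]].

(* Infimum of the positive integers satisfying A; +oo if there is none.       *)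
Definition first_time (R : realType) (A : nat -> Prop) : \bar R :=
  ereal_inf [set (t%:R : R)%:E | t in [set t : nat | (0 < t)%N /\ A t]].

Definition cesaro (R : realType) (n : nat) (P : 'M[R]_n) (t : nat) : 'M[R]_n :=
  t%:R^-1 *: \sum_(1 <= s < t.+1) P ^+ s.

(* The default value 0 of the maximum is harmless: its terms are nonnegative. *)
Definition tmix_TV (R : realType) (n : nat) (pi : 'rV[R]_n) (eps : R)
    (P : 'M[R]_n) : \bar R :=
  first_time R (fun t =>
    \big[Num.max/0]_(x < n) (2^-1 * \sum_y `|(P ^+ t) x y - pi 0 y|) < eps).

Definition avg_tmix_TV (R : realType) (n : nat) (pi : 'rV[R]_n) (eps : R)
    (P : 'M[R]_n) : \bar R :=
  first_time R (fun t => TV pi (P ^+ t) (Pi_mx pi) < eps).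

Definition avg_tmix_D (R : realType) (n : nat) (alpha : R) (pi : 'rV[R]_n)
    (eps : R) (P : 'M[R]_n) : \bar R :=
  first_time R (fun t => Dalpha alpha pi (P ^+ t) < eps).

Definition avg_tmix_R (R : realType) (n : nat) (alpha : R) (pi : 'rV[R]_n)
    (eps : R) (P : 'M[R]_n) : \bar R :=
  first_time R (fun t => Ralpha alpha pi (P ^+ t) < eps).

Definition tces_TV (R : realType) (n : nat) (pi : 'rV[R]_n) (eps : R)
    (P : 'M[R]_n) : \bar R :=
  first_time R (fun t => TV pi (cesaro P t) (Pi_mx pi) < eps).

Definition tces_D (R : realType) (n : nat) (alpha : R) (pi : 'rV[R]_n)
    (eps : R) (P : 'M[R]_n) : \bar R :=
  first_time R (fun t => Dalpha alpha pi (cesaro P t) < eps).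

Definition tces_R (R : realType) (n : nat) (alpha : R) (pi : 'rV[R]_n)
    (eps : R) (P : 'M[R]_n) : \bar R :=
  first_time R (fun t => Ralpha alpha pi (cesaro P t) < eps).

(* Main.v *)
(** The hypothesis on the Dobrushin coefficient says that any two rows of [P]
    are at L1 distance at most [2 theta]. A convex [f] agrees on finitely many
    points with an affine function plus a nonnegative combination of hinges
    [u |-> u - g + `|u - g|], so the L1 contraction passes to every
    f-divergence, in particular to [D_alpha]. With [d s] the divergence of
    [P ^+ s], convexity bounds the divergence of the Cesaro average by the mean
    of the [d s]: the terms before the mixing time [t] are at most [d 1], and
    those from [t] on have a geometric sum, below [eps / (1 - theta)]. For the
    Renyi divergence, [R_alpha < eps] amounts to [D_alpha < delta] for some
    [delta >= eps / (1 + eps)]. Without contraction of [P], [P ^+ t] at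
    [t = t_mix] still contracts by [2 eps]. *)
Require Import Defs.
From mathcomp Require Import all_boot all_order all_algebra.
From mathcomp Require Import all_classical all_reals all_analysis.
From mathcomp Require Import lra ring.

Set Implicit Arguments.
Unset Strict Implicit.
Unset Printing Implicit Defensive.

Import Order.TTheory GRing.Theory Num.Theory.

Local Open Scope ring_scope.

(** * L1 contraction of signed vectors *)

(* Couple the normalized positive and negative parts of [v]. *)
Lemma dobrushin_zero_sum (R : realFieldType) (I J : finType) (P : I -> J -> R)
    (rho : R) (v : I -> R) :
  (forall x y, \sum_z `|P x z - P y z| <= 2 * rho) -> \sum_x v x = 0 ->
  \sum_z `|\sum_x v x * P x z| <= rho * \sum_x `|v x|.
Proof.
move=> Prho v0.
pose p x := (`|v x| + v x) / 2; pose q x := (`|v x| - v x) / 2.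
pose V := (\sum_x `|v x|) / 2.
have p_ge0 x : 0 <= p x.
  by rewrite divr_ge0// -lerBlDr sub0r; apply: le_trans (ler_norm _) _; rewrite normrN.
have q_ge0 x : 0 <= q x by rewrite divr_ge0// subr_ge0 ler_norm.
have sp : \sum_x p x = V by rewrite -mulr_suml big_split/= v0 addr0.
have sq : \sum_x q x = V by rewrite -mulr_suml sumrB v0 subr0.
have pqE x : v x = p x - q x by rewrite /p /q; field.
have V_ge0 : 0 <= V by rewrite -sp sumr_ge0.
(* [p] and [q] both have mass [V], so their product is a coupling only up to normalization; hence
   the factor [V] on the left. *)
have couple z :
    V * \sum_x v x * P x z = \sum_x \sum_y p x * q y * (P x z - P y z).
  transitivity (\sum_x V * (p x * P x z) - \sum_y V * (q y * P y z)).
    rewrite -!mulr_sumr -mulrBr -sumrB; congr (_ * _).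
    by apply: eq_bigr => x _; rewrite pqE mulrBl.
  rewrite -{1}sq -{1}sp.
  under eq_bigr do rewrite mulr_suml.
  under [X in _ - X]eq_bigr do rewrite mulr_suml.
  rewrite [X in _ - X]exchange_big/= -sumrB; apply: eq_bigr => x _.
  by rewrite -sumrB; apply: eq_bigr => y _; ring.
have VE : \sum_x `|v x| = 2 * V by rewrite /V; field.
have : V * \sum_z `|\sum_x v x * P x z| <= V * (V * (2 * rho)).
  rewrite mulr_sumr.
  under eq_bigr do rewrite -{1}(ger0_norm V_ge0) -normrM couple.
  apply: (@le_trans _ _ (\sum_x \sum_y p x * q y * (2 * rho))); last first.
    by under eq_bigr do rewrite -mulr_suml -mulr_sumr sq; rewrite -2!mulr_suml sp mulrA.
  apply: (@le_trans _ _
    (\sum_z \sum_x \sum_y p x * q y * `|P x z - P y z|)).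
    apply: ler_sum => z _; apply: le_trans (ler_norm_sum _ _ _) _.
    apply: ler_sum => x _; apply: le_trans (ler_norm_sum _ _ _) _.
    by apply: ler_sum => y _; rewrite normrM ger0_norm// mulr_ge0.
  rewrite exchange_big; apply: ler_sum => x _.
  rewrite exchange_big; apply: ler_sum => y _.
  by rewrite -mulr_sumr ler_wpM2l// mulr_ge0.
(* The factor [V] cancels unless it is 0, in which case [v] itself vanishes. *)
have [V0|Vn0] := eqVneq V 0; last first.
  rewrite ler_pM2l ?lt_def ?Vn0// => /le_trans; apply.
  by rewrite VE mulrCA mulrA mulrC mulrA.
have v_eq0 x : v x = 0.
  apply: normr0_eq0; rewrite (psumr_eq0P (P := predT) (F := fun x => `|v x|))//.
  by rewrite VE V0 mulr0.
by move=> _; rewrite VE V0 !mulr0 big1// => z _; rewrite big1 ?normr0// => x _; rewrite v_eq0 mul0r.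
Qed.

(** A vector of mass [s > 0] splits into a zero-sum vector, which is contracted, and [s] times a
    probability vector, whose L1 norm the kernel preserves. *)
Lemma dobrushin_l1_ge0 (R : realFieldType) (I J : finType) (P : I -> J -> R)
    (rho : R) (v : I -> R) :
  (forall x z, 0 <= P x z) -> (forall x, \sum_z P x z = 1) ->
  (forall x y, \sum_z `|P x z - P y z| <= 2 * rho) -> 0 <= \sum_x v x ->
  \sum_z `|\sum_x v x * P x z|
    <= rho * \sum_x `|v x| + (1 - rho) * \sum_x v x.
Proof.
move=> P_ge0 P1 Prho; set s := \sum_x v x; rewrite le_eqVlt => /orP[/eqP s0|s_gt0].
  by rewrite -s0 mulr0 addr0; apply: dobrushin_zero_sum.
pose p x := (`|v x| + v x) / 2.
have p_ge0 x : 0 <= p x.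
  by rewrite divr_ge0// -lerBlDr sub0r; apply: le_trans (ler_norm _) _; rewrite normrN.
have v_le_p x : v x <= p x by have := ler_norm (v x); rewrite /p; lra.
pose V := \sum_x p x.
have sV : s <= V by apply: ler_sum.
have V_gt0 : 0 < V by apply: lt_le_trans sV.
pose w x := p x / V.
have w_ge0 x : 0 <= w x by rewrite divr_ge0// ltW.
have w1 : \sum_x w x = 1 by rewrite -mulr_suml divff ?gt_eqF.
(* Removing the mass [s] from the positive part leaves a zero-sum vector whose
   L1 norm is smaller by exactly [s]. *)
pose v' x := v x - s * w x.
have v'0 : \sum_x v' x = 0 by rewrite sumrB -mulr_sumr w1 mulr1 subrr.
have normv' x : `|v' x| = `|v x| - s * w x.
  have t_le1 : s / V <= 1 by rewrite ler_pdivrMr// mul1r.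
  have t_ge0 : 0 <= s / V by rewrite divr_ge0// ltW.
  rewrite /v' (_ : s * w x = s / V * p x); last by rewrite /w; ring.
  move: (s / V) t_le1 t_ge0 => t t_le1 t_ge0; rewrite /p.
  have [vx|vx] := leP 0 (v x).
    rewrite (ger0_norm vx) (_ : (v x + v x) / 2 = v x); last by field.
    by rewrite ger0_norm// subr_ge0 ler_piMl.
  by rewrite (ltr0_norm vx) addNr mul0r mulr0 !subr0 ltr0_norm.
have wP z : 0 <= \sum_x w x * P x z by rewrite sumr_ge0// => x _; rewrite mulr_ge0.
have sumwP : \sum_z \sum_x w x * P x z = 1.
  by rewrite exchange_big/= -w1; apply: eq_bigr => x _; rewrite -mulr_sumr P1 mulr1.
have vE z : \sum_x v x * P x z = \sum_x v' x * P x z + s * \sum_x w x * P x z.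
  by rewrite mulr_sumr -big_split/=; apply: eq_bigr => x _; rewrite /v'; ring.
apply: (@le_trans _ _ (\sum_z (`|\sum_x v' x * P x z| + s * \sum_x w x * P x z))).
  apply: ler_sum => z _; rewrite vE; apply: le_trans (ler_normD _ _) _.
  by rewrite lerD2l ger0_norm// mulr_ge0// ltW.
rewrite big_split/= -mulr_sumr sumwP mulr1.
have := @dobrushin_zero_sum _ _ _ P rho v' Prho v'0.
under [X in rho * X]eq_bigr do rewrite normv'.
rewrite sumrB -mulr_sumr w1 mulr1 => h.
apply: le_trans (lerD h (lexx s)) _.
by rewrite le_eqVlt; apply/orP; left; apply/eqP; ring.
Qed.

Lemma dobrushin_l1 (R : realFieldType) (I J : finType) (P : I -> J -> R)
    (rho : R) (v : I -> R) :
  (forall x z, 0 <= P x z) -> (forall x, \sum_z P x z = 1) ->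
  (forall x y, \sum_z `|P x z - P y z| <= 2 * rho) ->
  \sum_z `|\sum_x v x * P x z|
    <= rho * \sum_x `|v x| + (1 - rho) * `|\sum_x v x|.
Proof.
move=> P_ge0 P1 Prho; have [v_ge0|v_lt0] := leP 0 (\sum_x v x).
  by rewrite (ger0_norm v_ge0); exact: dobrushin_l1_ge0.
have := @dobrushin_l1_ge0 _ _ _ P rho (fun x => - v x) P_ge0 P1 Prho.
rewrite sumrN oppr_ge0 => /(_ (ltW v_lt0)).
under [X in X <= _]eq_bigr do under eq_bigr do rewrite mulNr.
under [X in X <= _]eq_bigr do rewrite sumrN normrN.
by under [X in rho * X]eq_bigr do rewrite normrN; rewrite (ltr0_norm v_lt0).
Qed.

(** * Convex functions as sums of hinges *)

(** Convexity on the half-line through supporting lines. They are asked only at [m > 0], since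
    [tsallis alpha] has slope minus infinity at 0 when [alpha < 1]. *)
Definition has_subgradients (R : realFieldType) (f : R -> R) :=
  forall m, 0 < m -> exists k, forall u, 0 <= u -> f m + k * (u - m) <= f u.

(** Twice the positive part of [u - g], written with an absolute value so that weighted sums of
    hinges become L1 norms. *)
Definition hinge (R : realFieldType) (g u : R) : R := u - g + `|u - g|.

(** Induction on the increasing points: prepending [x] bends the piecewise linear interpolant at
    [y], which costs one more hinge. The bound [y <= c.2] makes all hinges vanish at [x]. *)
Lemma hinge_interpolation_path (R : realFieldType) (f : R -> R) (s : seq R)
    (x y : R) :
  has_subgradients f -> 0 <= x -> path <%R x (y :: s) ->
  exists l : seq (R * R),
    (forall c, c \in l -> 0 <= c.1 /\ y <= c.2) /\
    (forall u, u \in x :: y :: s ->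
       f u = f x + (f y - f x) / (y - x) * (u - x)
             + \sum_(c <- l) c.1 * hinge c.2 u).
Proof.
move=> fsub; elim: s x y => [|z s IH] x y x_ge0 /= /andP[xy].
  move=> _; exists [::]; split=> // u; rewrite !inE big_nil addr0 => /orP[] /eqP->.
    by rewrite subrr mulr0 addr0.
  by rewrite divfK ?subr_eq0 ?gt_eqF// addrC subrK.
move=> yzs; have y_gt0 : 0 < y by apply: le_lt_trans xy.
have [l [l_ge lE]] := IH y z (ltW y_gt0) yzs.
have yz : y < z by case/andP: yzs.
have ys u : u \in y :: z :: s -> y <= u.
  rewrite inE => /predU1P[->//|us].
  by have /allP/(_ _ us)/ltW := order_path_min lt_trans (yzs : path <%R y (z :: s)).
pose sl a b := (f b - f a) / (b - a).
(* A hinge has slope 2 past its knot, so the weight is half the jump of the chord slopes. *)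
exists (((sl y z - sl x y) / 2, y) :: l); split.
  move=> c; rewrite inE => /predU1P[->|/l_ge[? ?]]; last first.
    by split=> //; apply: le_trans (ltW yz) _.
  split=> //=; rewrite divr_ge0// subr_ge0.
  (* A subgradient at [y] separates the slopes of the two chords meeting there. *)
  have [k kP] := fsub _ y_gt0.
  apply: (@le_trans _ _ k).
    by rewrite ler_pdivrMr ?subr_gt0//; have := kP x x_ge0; lra.
  rewrite ler_pdivlMr ?subr_gt0//.
  by have := kP z (ltW (lt_trans y_gt0 yz)); lra.
have fyE : f y = f x + sl x y * (y - x).
  by rewrite /sl divfK ?subr_eq0 ?gt_eqF// addrC subrK.
move=> u; rewrite inE => /predU1P[->|us].
  rewrite subrr mulr0 addr0 big1_seq ?addr0// => c /andP[_ cl].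
  have yc : y <= c.2.
    by move: cl; rewrite inE => /predU1P[->//|/l_ge[_ /(le_trans (ltW yz))]].
  rewrite /hinge ler0_norm ?subrr ?mulr0//.
  by rewrite subr_le0 (le_trans (ltW xy)).
rewrite big_cons [hinge _ u]/hinge/= (ger0_norm (_ : 0 <= u - y)); last first.
  by rewrite subr_ge0 ys.
rewrite lE// -/(sl y z) -/(sl x y) fyE.
by move: (\sum_(c <- l) _) (sl x y) (sl y z) => S a b; field.
Qed.

Lemma hinge_interpolation (R : realFieldType) (f : R -> R) (s : seq R) :
  has_subgradients f -> (forall u, u \in s -> 0 <= u) ->
  exists (a b : R) (l : seq (R * R)),
    (forall c, c \in l -> 0 <= c.1) /\
    (forall u, u \in s -> f u = a + b * u + \sum_(c <- l) c.1 * hinge c.2 u).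
Proof.
move=> fsub s_ge0; pose s' := sort <=%R (undup s).
have s's u : (u \in s') = (u \in s) by rewrite mem_sort mem_undup.
have : sorted <%R s' by rewrite sort_lt_sorted undup_uniq.
case: s' s's => [|x [|y t]] s's.
- by exists 0, 0, [::]; split=> // u; rewrite -s's.
- exists (f x), 0, [::]; split=> // u; rewrite -s's inE => /eqP->.
  by rewrite big_nil mul0r !addr0.
- move=> xyt; have [|l [l_ge lE]] := @hinge_interpolation_path _ f t x y fsub _ xyt.
    by apply: s_ge0; rewrite -s's mem_head.
  exists (f x - (f y - f x) / (y - x) * x), ((f y - f x) / (y - x)), l; split.
    by move=> c /l_ge[].
  move=> u; rewrite -s's => /lE->; ring.
Qed.

(** * Contraction of f-divergences *)

(** [r] is a density relative to [p], and [f] is applied on the left to the density of its image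
    under [P] relative to [q]. Both sides are linear in [f] and agree on affine functions, so hinges
    are enough. *)
Lemma fdiv_contraction (R : realFieldType) (I J : finType) (P : I -> J -> R)
    (rho : R) (f : R -> R) (p : I -> R) (q : J -> R) (r : I -> R) :
  has_subgradients f ->
  (forall x z, 0 <= P x z) -> (forall x, \sum_z P x z = 1) ->
  (forall x y, \sum_z `|P x z - P y z| <= 2 * rho) ->
  (forall x, 0 < p x) -> \sum_x p x = 1 ->
  (forall z, 0 < q z) -> (forall z, \sum_x p x * P x z = q z) ->
  (forall x, 0 <= r x) -> \sum_x p x * r x = 1 ->
  \sum_z q z * f ((\sum_x p x * r x * P x z) / q z)
    <= rho * \sum_x p x * f (r x) + (1 - rho) * f 1.
Proof.
move=> fsub P_ge0 P1 Prho p_gt0 p1 q_gt0 qE r_ge0 pr1.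
pose s z := (\sum_x p x * r x * P x z) / q z.
have q1 : \sum_z q z = 1.
  under eq_bigr do rewrite -qE; rewrite exchange_big/= -p1.
  by apply: eq_bigr => x _; rewrite -mulr_sumr P1 mulr1.
have qsE z : q z * s z = \sum_x p x * r x * P x z.
  by rewrite mulrC divfK ?gt_eqF.
have qs1 : \sum_z q z * s z = 1.
  under eq_bigr do rewrite qsE; rewrite exchange_big/= -pr1.
  by apply: eq_bigr => x _; rewrite -mulr_sumr P1 mulr1.
(* Up to the constant [1 - g], both sums are L1 norms, of the vector [p x * r x - g * p x] and of
   its image under [P]; its mass [1 - g] produces the term at 1. *)
have hinge_contraction g : \sum_z q z * hinge g (s z)
    <= rho * (\sum_x p x * hinge g (r x)) + (1 - rho) * hinge g 1.
  have hE (K : finType) (w t : K -> R) : (forall k, 0 < w k) ->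
      \sum_k w k = 1 -> \sum_k w k * t k = 1 ->
      \sum_k w k * hinge g (t k) = 1 - g + \sum_k `|w k * t k - g * w k|.
    move=> w_gt0 w1 wt1.
    transitivity (\sum_k (w k * t k - g * w k + `|w k * t k - g * w k|)).
      apply: eq_bigr => k _; rewrite /hinge.
      have -> : w k * t k - g * w k = w k * (t k - g) by ring.
      by rewrite mulrDr normrM (gtr0_norm (w_gt0 k)).
    by rewrite big_split sumrB -mulr_sumr w1 wt1 mulr1.
  rewrite !hE//.
  have := @dobrushin_l1 _ _ _ P rho (fun x => p x * r x - g * p x) P_ge0 P1 Prho.
  rewrite sumrB -mulr_sumr p1 pr1 mulr1.
  have -> : \sum_z `|\sum_x (p x * r x - g * p x) * P x z|
            = \sum_z `|q z * s z - g * q z|.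
    apply: eq_bigr => z _; rewrite qsE -qE mulr_sumr -sumrB.
    by congr `|_|; apply: eq_bigr => x _; rewrite mulrBl mulrA.
  by rewrite /hinge; lra.
(* All the points at which [f] is evaluated, including the 1 of the last term. *)
pose pts := 1 :: [seq r x | x <- enum I] ++ [seq s z | z <- enum J].
have [|a [b [l [l_ge0 fE]]]] := @hinge_interpolation _ f pts fsub.
  move=> u; rewrite inE mem_cat => /predU1P[->//|/orP[]/mapP[x _ ->]//].
  apply: divr_ge0; last exact: ltW.
  by apply: sumr_ge0 => y _; rewrite !mulr_ge0// ltW.
have rpts x : r x \in pts by rewrite inE mem_cat map_f ?mem_enum ?orbT.
have spts z : s z \in pts by rewrite inE mem_cat (map_f s) ?mem_enum ?orbT.
have expand (K : finType) (w t : K -> R) : (forall k, t k \in pts) ->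
    \sum_k w k = 1 -> \sum_k w k * t k = 1 ->
    \sum_k w k * f (t k)
    = a + b + \sum_(c <- l) c.1 * \sum_k w k * hinge c.2 (t k).
  move=> tpts w1 wt1.
  transitivity (\sum_k (a * w k + b * (w k * t k)
                        + \sum_(c <- l) c.1 * (w k * hinge c.2 (t k)))).
    apply: eq_bigr => k _; rewrite fE// mulrDr mulr_sumr; congr (_ + _).
      by ring.
    by apply: eq_bigr => c _; ring.
  rewrite !big_split/= -!mulr_sumr w1 wt1 !mulr1 exchange_big/=.
  by congr (_ + _); apply: eq_bigr => c _; rewrite mulr_sumr.
rewrite [leLHS]expand// (expand _ p r)// [f 1]fE ?mem_head// mulr1.
suff : \sum_(c <- l) c.1 * \sum_z q z * hinge c.2 (s z)
    <= rho * \sum_(c <- l) c.1 * \sum_x p x * hinge c.2 (r x)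
       + (1 - rho) * \sum_(c <- l) c.1 * hinge c.2 1 by lra.
rewrite !mulr_sumr -big_split/= big_seq [leRHS]big_seq.
apply: ler_sum => c /l_ge0 c_ge0.
by have := ler_wpM2l c_ge0 (hinge_contraction c.2); lra.
Qed.

(** * The convex generator of [Dalpha] *)

(** Young's inequality for the product of [powR u alpha] and 1, with conjugate exponents [alpha^-1]
    and [(1 - alpha)^-1]. *)
Lemma powR_bernoulli_le (R : realType) (alpha u : R) :
  0 < alpha -> alpha < 1 -> 0 <= u -> u `^ alpha <= alpha * u + (1 - alpha).
Proof.
move=> a_gt0 a_lt1 u_ge0.
have := @conjugate_powR R (u `^ alpha) 1 alpha^-1 (1 - alpha)^-1.
rewrite powR_ge0 ler01 !invr_gt0 subr_gt0 !invrK mulr1 powR1 mul1r.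
rewrite -powRrM divff ?gt_eqF// powRr1// mulrC => h.
by apply: h => //; ring.
Qed.

Lemma powR_bernoulli_ge (R : realType) (alpha u : R) :
  1 < alpha -> 0 <= u -> alpha * u + (1 - alpha) <= u `^ alpha.
Proof.
move=> a_gt1 u_ge0; have a_gt0 : 0 < alpha by apply: lt_trans a_gt1.
have := @powR_bernoulli_le R alpha^-1 (u `^ alpha).
rewrite invr_gt0 invf_lt1// powR_ge0 -powRrM divff ?gt_eqF// powRr1//.
move=> /(_ a_gt0 a_gt1 isT); rewrite -(ler_pM2l a_gt0) mulrDr mulrBr mulrA.
by rewrite divff ?gt_eqF// mul1r mulr1; lra.
Qed.

(** The sign of [(alpha - 1)^-1] makes this convex both for [alpha < 1] and for [alpha > 1]. *)
Definition tsallis (R : realType) (alpha u : R) : R :=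
  (alpha - 1)^-1 * (u `^ alpha - 1).

Lemma tsallis1 (R : realType) (alpha : R) : tsallis alpha 1 = 0.
Proof. by rewrite /tsallis powR1 subrr mulr0. Qed.

Lemma tsallis_bernoulli (R : realType) (alpha u : R) :
  0 < alpha -> alpha != 1 -> 0 <= u ->
  alpha / (alpha - 1) * (u - 1) <= tsallis alpha u.
Proof.
move=> a_gt0; have -> : alpha / (alpha - 1) * (u - 1)
    = (alpha - 1)^-1 * (alpha * (u - 1)) by ring.
rewrite neq_lt /tsallis => /orP[a_lt1|a_gt1] u_ge0.
  apply: ler_wnM2l; first by rewrite invr_le0 subr_le0 ltW.
  by have := powR_bernoulli_le a_gt0 a_lt1 u_ge0; lra.
apply: ler_wpM2l; first by rewrite invr_ge0 subr_ge0 ltW.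
by have := powR_bernoulli_ge a_gt1 u_ge0; lra.
Qed.

(** Homogeneity of the power function carries the tangent line at 1 to the one at [m]. *)
Lemma tsallis_subgradients (R : realType) (alpha : R) :
  0 < alpha -> alpha != 1 -> has_subgradients (tsallis alpha).
Proof.
move=> a_gt0 a_neq1 m m_gt0; exists (m `^ alpha / m * (alpha / (alpha - 1))).
move=> u u_ge0.
have am1 : alpha - 1 != 0 by rewrite subr_eq0.
have um_ge0 : 0 <= u / m by rewrite divr_ge0// ltW.
have := tsallis_bernoulli a_gt0 a_neq1 um_ge0.
have -> : tsallis alpha u = tsallis alpha m + m `^ alpha * tsallis alpha (u / m).
  by rewrite /tsallis -{1}(divfK (lt0r_neq0 m_gt0) u) powRM ?(ltW m_gt0)//; field.
move=> h; rewrite lerD2l; apply: le_trans (ler_wpM2l (powR_ge0 m alpha) h).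
rewrite le_eqVlt; apply/orP; left; apply/eqP; field.
by rewrite am1 gt_eqF.
Qed.

(** * Means and partial sums of sequences *)

Lemma mean_jensen (R : realFieldType) (f : R -> R) (T : nat) (u : nat -> R) :
  has_subgradients f -> (0 < T)%N -> (forall s, 0 <= u s) ->
  f (T%:R^-1 * \sum_(s < T) u s) <= T%:R^-1 * \sum_(s < T) f (u s).
Proof.
move=> fsub T_gt0 u_ge0; set m := T%:R^-1 * \sum_(s < T) u s.
have T_gt0' : 0 < T%:R :> R by rewrite ltr0n.
have mT : \sum_(s < T) u s = T%:R * m by rewrite /m mulrA divff ?mul1r ?gt_eqF.
have m_ge0 : 0 <= m by rewrite mulr_ge0 ?invr_ge0 ?(ltW T_gt0')// sumr_ge0.
rewrite -(ler_pM2l T_gt0') mulrA divff ?gt_eqF// mul1r.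
have -> : T%:R * f m = \sum_(s < T) f m by rewrite sumr_const card_ord mulr_natl.
(* No subgradient is available at 0, but a zero mean forces all the terms to be 0. *)
move: m_ge0; rewrite le_eqVlt => /orP[/eqP m0|m_gt0].
  apply: ler_sum => s _; suff -> : u s = m by [].
  rewrite -m0; apply: (psumr_eq0P (P := predT) (F := fun s : 'I_T => u s)) => //.
  by rewrite mT -m0 mulr0.
have [k kP] := fsub m m_gt0.
apply: (@le_trans _ _ (\sum_(s < T) (f m + k * (u s - m)))); last first.
  by apply: ler_sum => s _; apply: kP.
rewrite big_split/= -mulr_sumr sumrB mT [X in _ - X]sumr_const card_ord.
by rewrite mulr_natl subrr mulr0 addr0.
Qed.

(** Replaces a geometric series: cut the sum of [t + T] terms at [t] and contract the second piece.
    The scrambling case takes [t = 1]; the general bound takes the mixing time. *)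
Lemma contracted_partial_sum (R : realFieldType) (d : nat -> R) (rho : R)
    (t T : nat) :
  (forall s, 0 <= d s) -> (forall s, d (t + s)%N <= rho * d s) ->
  (1 - rho) * \sum_(s < T) d s <= \sum_(s < t) d s.
Proof.
move=> d_ge0 drho.
have shift : \sum_(s < T) d s <= \sum_(s < t) d s + rho * \sum_(s < T) d s.
  apply: (@le_trans _ _ (\sum_(s < t + T) d s)).
    rewrite addnC big_split_ord/= lerDl; exact: sumr_ge0.
  by rewrite big_split_ord/= lerD2l mulr_sumr; apply: ler_sum.
by lra.
Qed.

(** * First times *)

Lemma first_timeP (R : realType) (A : nat -> Prop) :
  (exists t, [/\ (0 < t)%N, A t & first_time R A = t%:R%:E]) \/
  first_time R A = +oo%E.
Proof.
have [Aex|nA] := pselect (exists t, `[< (0 < t)%N /\ A t >]).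
  case: (ex_minnP Aex) => t /asboolP[t_gt0 At] tmin; left; exists t; split=> //.
  apply/eqP; rewrite eq_le; apply/andP; split.
    by apply: ereal_inf_lbound; exists t.
  apply/ereal_infP => _ [u uA <-]; rewrite lee_fin ler_nat; apply: tmin.
  exact/asboolP.
right; rewrite /first_time (_ : [set _ | _ in _] = set0)%classic ?ereal_inf0//.
by apply/seteqP; split=> // x [t tA _]; apply: nA; exists t; apply/asboolP.
Qed.

Lemma first_time_ge0 (R : realType) (A : nat -> Prop) : (0 <= first_time R A)%E.
Proof. by apply/ereal_infP => _ [t _ <-]; rewrite lee_fin. Qed.

(* The bound [x] need not be an integer: take [T] to be its integer part. *)
Lemma first_time_le (R : realType) (A : nat -> Prop) (x : R) :
  1 <= x -> (forall T, (0 < T)%N -> x - 1 < T%:R -> A T) ->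
  (first_time R A <= x%:E)%E.
Proof.
move=> x_ge1 AT; have /truncn_itv/andP[Tx xT] := le_trans ler01 x_ge1.
have T_gt0 : (0 < Num.truncn x)%N.
  by rewrite lt0n; apply/eqP => T0; move: xT; rewrite T0 ltNge x_ge1.
apply: (@le_trans _ _ (Num.truncn x)%:R%:E); last by rewrite lee_fin.
apply: ereal_inf_lbound; exists (Num.truncn x) => //; split=> //.
by apply: AT => //; rewrite ltrBlDr natr1.
Qed.

(** Common core of the scrambling bounds: [d] stands for the divergence of the powers and [c] for
    that of the Cesaro averages. [D0] is kept apart from [d 1] so that it can be 1 for total
    variation. *)
Lemma cesaro_first_time (R : realType) (d c : nat -> R) (D0 theta delta : R) :
  0 < theta -> theta < 1 -> 0 < delta ->
  (forall s, 0 <= d s) -> (forall s, d s.+2 <= theta * d s.+1) -> d 1%N <= D0 ->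
  (forall T, (0 < T)%N -> c T <= T%:R^-1 * \sum_(s < T) d s.+1) ->
  (first_time R (fun t => (c t < delta)%R)
     <= (D0 / delta)%:E * first_time R (fun t => (d t < delta)%R)
        + (1 / (1 - theta))%:E)%E.
Proof.
move=> th_gt0 th_lt1 delta_gt0 d_ge0 dth d1 cT.
have D0_ge0 : 0 <= D0 by apply: le_trans d1.
have omth_gt0 : 0 < 1 - theta by rewrite subr_gt0.
have inv_ge1 : 1 <= 1 / (1 - theta) by rewrite ler_pdivlMr// mul1r gerBl ltW.
have d_le s : d s.+1 <= D0.
  elim: s => // s IH; apply: le_trans (dth s) _; apply: le_trans IH.
  by apply: ler_piMl => //; apply: ltW.
(* If [d 1 < delta], time 1 already works. Otherwise [D0 >= delta > 0], so an infinite mixing time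
   does make the right-hand side infinite. *)
have [d_lt|d_ge] := ltP (d 1%N) delta.
  apply: (@le_trans _ _ 1%:E).
    apply: ereal_inf_lbound; exists 1%N => //; split=> //=.
    by apply: le_lt_trans (cT 1%N isT) _; rewrite big_ord1 invr1 mul1r.
  apply: (@le_trans _ _ (1 / (1 - theta))%:E); first by rewrite lee_fin.
  rewrite leeDr// mule_ge0 ?first_time_ge0// lee_fin.
  by rewrite divr_ge0// ltW.
have D0_ge : delta <= D0 by apply: le_trans d1.
have D0_gt0 : 0 < D0 by apply: lt_le_trans D0_ge.
case: (@first_timeP R (fun t => d t < delta)) => [[t []]|->]; last first.
  by rewrite gt0_muley ?lte_fin ?divr_gt0// addye// leey.
(* With mixing time [t.+1], the [t] earlier terms are bounded by [D0] and the tail starts at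
   [d t.+1 < delta]. *)
case: t => // t _ dt ->; rewrite -EFinM -EFinD; apply: first_time_le.
  by apply: le_trans inv_ge1 _; rewrite lerDr mulr_ge0// divr_ge0// ltW.
move=> T T_gt0 T_gt.
have T_gt0' : 0 < T%:R :> R by rewrite ltr0n.
apply: le_lt_trans (cT T T_gt0) _; rewrite mulrC ltr_pdivrMr//.
have tail : (1 - theta) * \sum_(s < T) d (t + s).+1 <= d t.+1.
  have := @contracted_partial_sum _ (fun s => d (t + s).+1) theta 1 T.
  rewrite big_ord1 addn0; apply=> // s.
  by rewrite add1n addnS.
apply: (@le_lt_trans _ _ (\sum_(s < t) D0 + \sum_(s < T) d (t + s).+1)).
  apply: (@le_trans _ _ (\sum_(s < t + T) d s.+1)).
    rewrite addnC big_split_ord/= lerDl; exact: sumr_ge0.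
  by rewrite big_split_ord/= lerD2r; apply: ler_sum.
rewrite sumr_const card_ord -mulr_natl.
have tail' : \sum_(s < T) d (t + s).+1 < delta / (1 - theta).
  by rewrite ltr_pdivlMr// mulrC; apply: le_lt_trans dt.
(* The rounding loss of 1 costs [delta], which is paid by the spare [D0 >= delta]: the head has one
   term fewer than the mixing time. *)
have : delta * (D0 / delta * t.+1%:R + 1 / (1 - theta) - 1) < delta * T%:R.
  by rewrite ltr_pM2l.
have -> : delta * (D0 / delta * t.+1%:R + 1 / (1 - theta) - 1)
   = D0 * (t%:R + 1) + delta / (1 - theta) - delta.
  by rewrite -natr1; field; rewrite !gt_eqF.
by lra.
Qed.

(** * Transition matrices and stationarity *)

Lemma transition_mulmx (R : realType) (n : nat) (A B : 'M[R]_n) :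
  transition_matrix A -> transition_matrix B -> transition_matrix (A *m B).
Proof.
move=> [A_ge0 A1] [B_ge0 B1]; split=> [x y|x].
  by rewrite mxE sumr_ge0// => z _; rewrite mulr_ge0.
under eq_bigr do rewrite mxE; rewrite exchange_big/= -(A1 x).
by apply: eq_bigr => z _; rewrite -mulr_sumr B1 mulr1.
Qed.

Lemma transition_exp (R : realType) (n : nat) (P : 'M[R]_n) (s : nat) :
  transition_matrix P -> transition_matrix (P ^+ s).
Proof.
move=> tP; elim: s => [|s IH]; last by rewrite exprS; apply: transition_mulmx.
rewrite expr0; split=> [x y|x]; first by rewrite mxE ler0n.
rewrite (bigD1 x)//= mxE eqxx big1 ?addr0// => y.
by rewrite mxE eq_sym => /negPf->.
Qed.

Lemma stationary_exp (R : realType) (n : nat) (pi : 'rV[R]_n) (P : 'M[R]_n)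
    (s : nat) :
  stationary pi P -> stationary pi (P ^+ s).
Proof.
move=> [dpi piP]; split=> //; elim: s => [|s IH]; first by rewrite expr0 mulmx1.
by rewrite exprS mulmxA piP.
Qed.

Lemma distribution_gt0 (R : realType) (n : nat) (pi : 'rV[R]_n) :
  Defs.distribution pi -> exists x, 0 < pi 0 x.
Proof.
move=> [pi_ge0 pi1]; apply/existsP; apply: contraT; rewrite negb_exists.
move=> /forallP pi_le0; have := oner_neq0 R; rewrite -pi1 big1 ?eqxx// => x _.
by apply/eqP; rewrite eq_le pi_ge0 leNgt pi_le0.
Qed.

(** Some state has mass, irreducibility sends part of it to [x], and [pi] is invariant under that
    power. This makes the divisions in [Dalpha] genuine. *)
Lemma stationary_gt0 (R : realType) (n : nat) (pi : 'rV[R]_n) (P : 'M[R]_n) :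
  transition_matrix P -> irreducible P -> stationary pi P ->
  forall x, 0 < pi 0 x.
Proof.
move=> tP irrP stP x; have [dpi _] := stP; have [pi_ge0 _] := dpi.
have [y y_gt0] := distribution_gt0 dpi.
have [t [_ Pt_gt0]] := irrP y x.
have [Pt_ge0 _] := transition_exp t tP.
have [_ <-] := stationary_exp t stP.
rewrite mxE (bigD1 y)//= ltr_pwDl ?mulr_gt0// sumr_ge0// => z _.
by rewrite mulr_ge0.
Qed.

Lemma mulmx_Pi (R : realType) (n : nat) (pi : 'rV[R]_n) (P : 'M[R]_n) :
  stationary pi P -> Pi_mx pi *m P = Pi_mx pi.
Proof.
move=> [_ piP]; apply/matrixP => x y; rewrite !mxE -[in RHS]piP mxE.
by apply: eq_bigr => z _; rewrite mxE.
Qed.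

Lemma transition_Pi (R : realType) (n : nat) (pi : 'rV[R]_n) :
  Defs.distribution pi -> transition_matrix (Pi_mx pi).
Proof.
move=> [pi_ge0 pi1]; split=> [x y|x]; first by rewrite mxE.
by under eq_bigr do rewrite mxE.
Qed.

Lemma cesaroE (R : realType) (n : nat) (P : 'M[R]_n) (T : nat) x y :
  Defs.cesaro P T x y = T%:R^-1 * \sum_(s < T) (P ^+ s.+1) x y.
Proof. by rewrite mxE summxE big_add1/= big_mkord. Qed.

Lemma transition_cesaro (R : realType) (n : nat) (P : 'M[R]_n) (T : nat) :
  (0 < T)%N -> transition_matrix P -> transition_matrix (Defs.cesaro P T).
Proof.
move=> T_gt0 tP; split=> [x y|x].
  rewrite cesaroE mulr_ge0 ?invr_ge0// sumr_ge0// => s _.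
  by have [h _] := transition_exp s.+1 tP.
under eq_bigr do rewrite cesaroE; rewrite -mulr_sumr exchange_big/=.
under eq_bigr do rewrite (transition_exp _ tP).2.
by rewrite sumr_const card_ord mulVf// pnatr_eq0 -lt0n.
Qed.

(** * Total variation *)

Lemma row_dist_le2 (R : realType) (n : nat) (M L : 'M[R]_n) x y :
  transition_matrix M -> transition_matrix L ->
  \sum_z `|M x z - L y z| <= 2.
Proof.
move=> [M_ge0 M1] [L_ge0 L1].
apply: (@le_trans _ _ (\sum_z (M x z + L y z))).
  by apply: ler_sum => z _; apply: le_trans (ler_normB _ _) _; rewrite !ger0_norm.
by rewrite big_split/= M1 L1.
Qed.

Lemma TV_ge0 (R : realType) (n : nat) (pi : 'rV[R]_n) (M L : 'M[R]_n) :
  Defs.distribution pi -> 0 <= TV pi M L.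
Proof.
move=> [pi_ge0 _]; rewrite mulr_ge0// sumr_ge0// => x _.
by rewrite sumr_ge0// => y _; rewrite mulr_ge0.
Qed.

Lemma TV_le1 (R : realType) (n : nat) (pi : 'rV[R]_n) (M L : 'M[R]_n) :
  Defs.distribution pi -> transition_matrix M -> transition_matrix L ->
  TV pi M L <= 1.
Proof.
move=> [pi_ge0 pi1] tM tL; rewrite /TV -ler_pdivlMl ?invr_gt0// invrK mulr1.
apply: (@le_trans _ _ (\sum_x pi 0 x * 2)); last by rewrite -mulr_suml pi1 mul1r.
by apply: ler_sum => x _; rewrite -mulr_sumr ler_wpM2l// row_dist_le2.
Qed.

Lemma TV_lt (R : realType) (n : nat) (pi : 'rV[R]_n) (M L : 'M[R]_n) (e : R) :
  Defs.distribution pi ->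
  (forall x, 2^-1 * \sum_y `|M x y - L x y| < e) -> TV pi M L < e.
Proof.
move=> dpi Me; have [pi_ge0 pi1] := dpi.
have [y y_gt0] := distribution_gt0 dpi.
rewrite /TV mulr_sumr (_ : e = \sum_x pi 0 x * e); last first.
  by rewrite -mulr_suml pi1 mul1r.
(* Isolating a state of positive mass keeps the inequality strict. *)
rewrite (bigD1 y)//= [ltRHS](bigD1 y)//=; apply: ltr_leD.
  by rewrite -mulr_sumr mulrCA ltr_pM2l.
by apply: ler_sum => x _; rewrite -mulr_sumr mulrCA ler_wpM2l// ltW.
Qed.

(** The rows of [M - L] have zero sum, so the zero-sum contraction applies to each. *)
Lemma TV_mulmx_le (R : realType) (n : nat) (pi : 'rV[R]_n) (M L P : 'M[R]_n)
    (rho : R) :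
  Defs.distribution pi -> transition_matrix M -> transition_matrix L ->
  (forall x y, \sum_z `|P x z - P y z| <= 2 * rho) ->
  TV pi (M *m P) (L *m P) <= rho * TV pi M L.
Proof.
move=> [pi_ge0 _] [_ M1] [_ L1] Prho; rewrite /TV mulrCA ler_wpM2l// mulr_sumr.
apply: ler_sum => x _; rewrite -!mulr_sumr mulrCA ler_wpM2l//.
have := @dobrushin_zero_sum _ _ _ P rho (fun y => M x y - L x y) Prho.
rewrite sumrB M1 L1 subrr => /(_ erefl); apply: le_trans.
apply: ler_sum => z _; rewrite !mxE -sumrB.
by under eq_bigr do rewrite -mulrBl.
Qed.

Lemma TV_exp_le (R : realType) (n : nat) (pi : 'rV[R]_n) (P : 'M[R]_n)
    (rho : R) (t s : nat) :
  transition_matrix P -> stationary pi P ->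
  (forall x y, \sum_z `|(P ^+ t) x z - (P ^+ t) y z| <= 2 * rho) ->
  TV pi (P ^+ (t + s)) (Pi_mx pi) <= rho * TV pi (P ^+ s) (Pi_mx pi).
Proof.
move=> tP stP Prho; have [dpi _] := stP.
rewrite addnC exprD -{1}(mulmx_Pi (stationary_exp t stP)); apply: TV_mulmx_le => //.
  exact: transition_exp.
exact: transition_Pi.
Qed.

Lemma TV_cesaro_le (R : realType) (n : nat) (pi : 'rV[R]_n) (P L : 'M[R]_n)
    (T : nat) :
  Defs.distribution pi -> (0 < T)%N ->
  TV pi (Defs.cesaro P T) L <= T%:R^-1 * \sum_(s < T) TV pi (P ^+ s.+1) L.
Proof.
move=> [pi_ge0 _] T_gt0; have T_neq0 : T%:R != 0 :> R by rewrite pnatr_eq0 -lt0n.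
rewrite /TV -mulr_sumr mulrCA ler_wpM2l// [X in _ * X]exchange_big/= mulr_sumr.
apply: ler_sum => x _; rewrite exchange_big/= mulr_sumr.
apply: ler_sum => y _; rewrite -mulr_sumr mulrCA ler_wpM2l// cesaroE.
rewrite [in leLHS](_ : L x y = T%:R^-1 * \sum_(s < T) L x y).
  rewrite -mulrBr -sumrB normrM ger0_norm ?invr_ge0//.
  by apply: ler_wpM2l (ler_norm_sum _ _ _); rewrite invr_ge0.
by rewrite sumr_const card_ord -[L x y *+ T]mulr_natl mulrA mulVf ?mul1r.
Qed.

(** * The divergences [Dalpha] and [Ralpha] *)

Lemma Dalpha_tsallis (R : realType) (n : nat) (alpha : R) (pi : 'rV[R]_n)
    (M : 'M[R]_n) :
  Defs.distribution pi ->
  Dalpha alpha pi M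
    = \sum_x pi 0 x * \sum_y pi 0 y * tsallis alpha (M x y / pi 0 y).
Proof.
move=> [_ pi1]; rewrite /Dalpha.
have pipi1 : \sum_x \sum_y pi 0 x * pi 0 y = 1.
  by under eq_bigr do rewrite -mulr_sumr pi1 mulr1.
rewrite -[in X in _ * X]pipi1 -sumrB mulr_sumr; apply: eq_bigr => x _.
rewrite -sumrB !mulr_sumr; apply: eq_bigr => y _.
by rewrite /tsallis; ring.
Qed.

(** For each row of [M], this is the f-divergence contraction with [p] and [q] both equal to [pi];
    the additive term drops because the generator vanishes at 1. *)
Lemma Dalpha_mulmx_le (R : realType) (n : nat) (alpha : R) (pi : 'rV[R]_n)
    (M P : 'M[R]_n) (rho : R) :
  0 < alpha -> alpha != 1 -> transition_matrix M -> transition_matrix P ->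
  stationary pi P -> (forall x, 0 < pi 0 x) ->
  (forall x y, \sum_z `|P x z - P y z| <= 2 * rho) ->
  Dalpha alpha pi (M *m P) <= rho * Dalpha alpha pi M.
Proof.
move=> a_gt0 a_neq1 [M_ge0 M1] [P_ge0 P1] [dpi piP] pi_gt0 Prho.
have [pi_ge0 pi1] := dpi.
rewrite !Dalpha_tsallis// mulr_sumr; apply: ler_sum => x _.
rewrite mulrCA ler_wpM2l//.
have piM y : pi 0 y * (M x y / pi 0 y) = M x y by rewrite mulrC divfK ?gt_eqF.
have : \sum_z pi 0 z * tsallis alpha
      ((\sum_y pi 0 y * (M x y / pi 0 y) * P y z) / pi 0 z)
    <= rho * \sum_y pi 0 y * tsallis alpha (M x y / pi 0 y)
       + (1 - rho) * tsallis alpha 1.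
  apply: fdiv_contraction => //.
  - exact: tsallis_subgradients.
  - by move=> z; rewrite -[in RHS]piP mxE.
  - by move=> y; rewrite divr_ge0// ltW.
  - by under eq_bigr do rewrite piM.
rewrite tsallis1 mulr0 addr0 => /(le_trans _); apply.
apply: ler_sum => z _; rewrite mxE.
by under [in leRHS]eq_bigr do rewrite piM.
Qed.

(** The supporting line of the generator at 1 has zero [pi]-mean along each row. *)
Lemma Dalpha_ge0 (R : realType) (n : nat) (alpha : R) (pi : 'rV[R]_n)
    (M : 'M[R]_n) :
  0 < alpha -> alpha != 1 -> transition_matrix M ->
  Defs.distribution pi -> (forall x, 0 < pi 0 x) ->
  0 <= Dalpha alpha pi M.
Proof.
move=> a_gt0 a_neq1 [M_ge0 M1] dpi pi_gt0; have [pi_ge0 pi1] := dpi.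
rewrite Dalpha_tsallis// sumr_ge0// => x _; rewrite mulr_ge0//.
have [k kP] := tsallis_subgradients a_gt0 a_neq1 ltr01.
apply: (@le_trans _ _ (\sum_y pi 0 y * (k * (M x y / pi 0 y - 1)))).
  have -> : \sum_y pi 0 y * (k * (M x y / pi 0 y - 1))
      = k * \sum_y (M x y - pi 0 y).
    rewrite mulr_sumr; apply: eq_bigr => y _; field.
    by rewrite gt_eqF.
  by rewrite sumrB M1 pi1 subrr mulr0.
apply: ler_sum => y _; rewrite ler_wpM2l//.
have := kP (M x y / pi 0 y); rewrite tsallis1 add0r; apply.
by rewrite divr_ge0// ltW.
Qed.

Lemma Dalpha_cesaro_le (R : realType) (n : nat) (alpha : R) (pi : 'rV[R]_n)
    (P : 'M[R]_n) (T : nat) :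
  0 < alpha -> alpha != 1 -> transition_matrix P ->
  Defs.distribution pi -> (forall x, 0 < pi 0 x) -> (0 < T)%N ->
  Dalpha alpha pi (Defs.cesaro P T)
    <= T%:R^-1 * \sum_(s < T) Dalpha alpha pi (P ^+ s.+1).
Proof.
move=> a_gt0 a_neq1 tP dpi pi_gt0 T_gt0; have [pi_ge0 _] := dpi.
under [X in _ * X]eq_bigr do rewrite Dalpha_tsallis//.
rewrite Dalpha_tsallis// exchange_big/= mulr_sumr; apply: ler_sum => x _.
rewrite -mulr_sumr mulrCA ler_wpM2l// exchange_big/= mulr_sumr.
apply: ler_sum => y _; rewrite -mulr_sumr [leRHS]mulrCA ler_wpM2l//.
have := @mean_jensen _ _ T (fun s => (P ^+ s.+1) x y / pi 0 y)
  (tsallis_subgradients a_gt0 a_neq1) T_gt0.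
rewrite cesaroE -mulr_suml mulrA; apply=> s.
by rewrite divr_ge0//; have [] := transition_exp s.+1 tP.
Qed.

(** Solving the Renyi condition for [Dalpha] reduces the Renyi bound to the one for [Dalpha] at
    another threshold. *)
Lemma Ralpha_threshold (R : realType) (n : nat) (alpha : R) (pi : 'rV[R]_n)
    (eps : R) :
  0 < alpha -> alpha != 1 -> 0 < eps -> Defs.distribution pi ->
  (forall x, 0 < pi 0 x) ->
  exists delta : R, eps / (1 + eps) <= delta /\
    forall M : 'M[R]_n, transition_matrix M ->
      (Ralpha alpha pi M < eps <-> Dalpha alpha pi M < delta).
Proof.
move=> a_gt0 a_neq1 eps_gt0 dpi pi_gt0; have [pi_ge0 pi1] := dpi.
have am1 : alpha - 1 != 0 by rewrite subr_eq0.
pose z := (alpha - 1) * eps.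
exists ((expR z - 1) / (alpha - 1)); split.
  move: (a_neq1); rewrite neq_lt => /orP[a_lt1|a_gt1].
    have e_gt0 := expR_gt0 z.
    (* From [expR (- z) >= 1 - z]; it gives [delta >= eps / (1 + eps * (1 - alpha))]. For
       [alpha > 1], [expR z >= 1 + z] even gives [delta >= eps]. *)
    have h : expR z * (1 - z) <= 1.
      rewrite -[X in _ <= X](expR0) -(subrr z) expRD ler_pM2l//.
      exact: expR_ge1Dx.
    have -> : (expR z - 1) / (alpha - 1) = (1 - expR z) / (1 - alpha).
      by rewrite -(opprB alpha 1) -(opprB (expR z) 1) invrN mulrNN.
    rewrite ler_pdivlMr ?subr_gt0// mulrAC ler_pdivrMr ?addr_gt0//.
    have zE : z = - (eps * (1 - alpha)) by rewrite /z; ring.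
    have : 0 < eps * (1 - alpha) by rewrite mulr_gt0// subr_gt0.
    have : 0 < eps * alpha by rewrite mulr_gt0.
    move: h e_gt0; rewrite zE opprK; nra.
  rewrite ler_pdivlMr ?subr_gt0//; apply: (@le_trans _ _ z).
    rewrite /z mulrC ler_wpM2l ?subr_ge0 ?(ltW a_gt1)//.
    rewrite ler_pdivrMr ?addr_gt0// ler_peMr ?(ltW eps_gt0)// lerDl ltW//.
  by rewrite lerBrDl; apply: expR_ge1Dx.
move=> M [M_ge0 M1]; rewrite /Ralpha; set D := Dalpha alpha pi M.
(* [ln] is increasing only on positive arguments. *)
have DS : 0 < 1 + (alpha - 1) * D.
  rewrite /D /Dalpha mulrA divff// mul1r addrC subrK.
  have [x x_gt0] := distribution_gt0 dpi.
  have [y y_gt0] : exists y, 0 < (\row_y M x y) 0 y.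
    apply: distribution_gt0; split=> [y|]; first by rewrite mxE.
    by under eq_bigr do rewrite mxE.
  rewrite mxE in y_gt0.
  have S_ge0 u v : 0 <= pi 0 u * pi 0 v * (M u v / pi 0 v) `^ alpha.
    by rewrite !mulr_ge0// powR_ge0.
  rewrite (bigD1 x)//= ltr_pwDl//; last first.
    by rewrite sumr_ge0// => u _; rewrite sumr_ge0.
  rewrite (bigD1 y)//= ltr_pwDl// ?sumr_ge0//.
  by rewrite !mulr_gt0// powR_gt0// divr_gt0.
have lnE : (ln (1 + (alpha - 1) * D) < z) = (1 + (alpha - 1) * D < expR z).
  by rewrite -[in RHS](lnK DS) ltr_expR.
have lnE' : (z < ln (1 + (alpha - 1) * D)) = (expR z < 1 + (alpha - 1) * D).
  by rewrite -[in RHS](lnK DS) ltr_expR.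
(* Exposes the factor [(alpha - 1)^-1] on both sides of each comparison; being negative for
   [alpha < 1], it reverses them there, whence [lnE']. *)
rewrite -(mulKf am1 eps) -/z ![_ / (alpha - 1)]mulrC -[D in _ <-> D < _](mulKf am1).
move: (a_neq1); rewrite neq_lt => /orP[a_lt1|a_gt1].
  rewrite !ltr_nM2l ?invr_lt0 ?subr_lt0// lnE'.
  by rewrite ltrBlDl.
by rewrite !ltr_pM2l ?invr_gt0 ?subr_gt0// lnE ltrBrDl.
Qed.

Lemma first_time_ext (R : realType) (A B : nat -> Prop) :
  (forall t, (0 < t)%N -> A t <-> B t) -> first_time R A = first_time R B.
Proof.
move=> AB; rewrite /first_time; congr (ereal_inf (_ @` _)%classic).
by apply/seteqP; split=> t /= [t_gt0 /(AB t t_gt0)].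
Qed.

(** * The Dobrushin coefficient and scrambling *)

(** Test kernels for the supremum: every row of [point_mx R x *m P] is row [x] of [P]. *)
Definition point_mx (R : realType) (n : nat) (x : 'I_n) : 'M[R]_n :=
  \matrix_(_, y) (y == x)%:R.

Lemma point_mx_sum (R : realType) (n : nat) (x : 'I_n) (f : 'I_n -> R) w :
  \sum_y point_mx R x w y * f y = f x.
Proof.
rewrite (bigD1 x)//= mxE eqxx mul1r big1 ?addr0// => y /negPf yx.
by rewrite mxE yx mul0r.
Qed.

Lemma transition_point_mx (R : realType) (n : nat) (x : 'I_n) :
  transition_matrix (point_mx R x).
Proof.
split=> [w y|w]; first by rewrite mxE.
by rewrite -(@point_mx_sum R n x (fun=> 1) w); apply: eq_bigr => y _; rewrite mulr1.
Qed.

Lemma eta_TV_row_dist (R : realType) (n : nat) (pi : 'rV[R]_n) (P : 'M[R]_n)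
    (theta : R) :
  Defs.distribution pi -> 0 <= theta -> (eta_TV pi P <= theta%:E)%E ->
  forall x y, \sum_z `|P x z - P y z| <= 2 * theta.
Proof.
move=> [pi_ge0 pi1] th_ge0 eta_le x y.
(* The supremum ranges over distinct kernels, so equal states are treated apart. *)
have [->|xy] := eqVneq x y.
  by rewrite big1 ?mulr_ge0// => z _; rewrite subrr normr0.
have TVpoint : TV pi (point_mx R x) (point_mx R y) = 1.
  rewrite /TV -[RHS](@mulVf R 2) ?pnatr_eq0//.
  congr (_ * _); under eq_bigr do rewrite -mulr_sumr.
  rewrite -[RHS]mul1r -[X in _ = X * _]pi1 mulr_suml; apply: eq_bigr => w _; congr (_ * _).
  rewrite (bigD1 x)//= (bigD1 y) 1?eq_sym//= big1 => [|z /andP[zx zy]].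
    rewrite !mxE !eqxx (negPf xy) eq_sym (negPf xy).
    by rewrite subr0 sub0r normrN normr1 addr0.
  by rewrite !mxE (negPf zx) (negPf zy) subrr normr0.
have TVpointP : TV pi (point_mx R x *m P) (point_mx R y *m P)
    = 2^-1 * \sum_z `|P x z - P y z|.
  rewrite /TV; congr (_ * _); under eq_bigr do rewrite -mulr_sumr.
  rewrite -[RHS]mul1r -[X in _ = X * _]pi1 mulr_suml; apply: eq_bigr => w _; congr (_ * _).
  by apply: eq_bigr => z _; rewrite !mxE !point_mx_sum.
rewrite -ler_pdivrMl// -TVpointP -[leLHS]divr1 -TVpoint -lee_fin.
apply: le_trans eta_le; apply: ereal_sup_ubound.
exists (point_mx R x), (point_mx R y); split=> //.
- exact: transition_point_mx.
- exact: transition_point_mx.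
- move=> /matrixP/(_ x x); rewrite !mxE eqxx (negPf xy) => /eqP.
  by rewrite oner_eq0.
Qed.

Lemma eta_TV_le (R : realType) (n : nat) (pi : 'rV[R]_n) (P : 'M[R]_n)
    (rho : R) :
  Defs.distribution pi -> 0 <= rho ->
  (forall x y, \sum_z `|P x z - P y z| <= 2 * rho) ->
  (eta_TV pi P <= rho%:E)%E.
Proof.
move=> dpi rho_ge0 Prho; apply: ge_ereal_sup => _ [M [L [tM tL _ ->]]].
(* Distinct kernels may have [TV pi M L = 0] when [pi] lacks full support; the quotient is then 0 by
   convention. *)
rewrite lee_fin; have [->|TVn0] := eqVneq (TV pi M L) 0.
  by rewrite invr0 mulr0.
by rewrite ler_pdivrMr ?TV_mulmx_le// lt_def TVn0 TV_ge0.
Qed.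

(** For nonnegative reals, [|a - b| <= a + b] is strict exactly when both are positive, and here the
    right-hand sides sum to 2. *)
Lemma row_dist_lt2P (R : realType) (n : nat) (P : 'M[R]_n) x y :
  transition_matrix P ->
  (\sum_z `|P x z - P y z| < 2) <-> exists z, 0 < P x z /\ 0 < P y z.
Proof.
move=> [P_ge0 P1].
have sum2 : \sum_z (P x z + P y z) = 2 by rewrite big_split/= !P1.
have norm_le z : `|P x z - P y z| <= P x z + P y z.
  by apply: le_trans (ler_normB _ _) _; rewrite !ger0_norm.
split=> [lt2|[z [Pxz Pyz]]]; last first.
  rewrite -sum2 (bigD1 z)//= [ltRHS](bigD1 z)//=; apply: ltr_leD.
    by rewrite ltr_norml; lra.
  by apply: ler_sum.
apply: contrapT => nz; move: lt2; rewrite -sum2 ltNge => /negP; apply.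
apply: ler_sum => z _.
have [Pxz|Pxz] := ltP 0 (P x z); last first.
  have -> : P x z = 0 by apply/eqP; rewrite eq_le Pxz P_ge0.
  by rewrite sub0r add0r normrN ler_norm.
have -> : P y z = 0.
  apply/eqP; rewrite eq_le P_ge0 leNgt andbT; apply/negP => Pyz.
  by apply: nz; exists z.
by rewrite subr0 addr0 ler_norm.
Qed.

Lemma eta_TV_lt1P (R : realType) (n : nat) (pi : 'rV[R]_n) (P : 'M[R]_n) :
  Defs.distribution pi -> transition_matrix P ->
  (exists theta : R, [/\ 0 < theta, theta < 1 & (eta_TV pi P <= theta%:E)%E])
  <-> scrambling P.
Proof.
move=> dpi tP; split=> [[theta [th_gt0 th_lt1 eta_le]] x y|sP].
  apply/row_dist_lt2P => //.
  apply: le_lt_trans (eta_TV_row_dist dpi (ltW th_gt0) eta_le x y) _.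
  by rewrite gtr_pMr.
(* A maximum over finitely many pairs stays below 1; the default [2^-1] keeps it positive. *)
pose rho := \big[Num.max/2^-1]_(u : 'I_n * 'I_n)
  (2^-1 * \sum_z `|P u.1 z - P u.2 z|).
have rho_gt0 : 0 < rho.
  by apply: (@lt_le_trans _ _ 2^-1); [rewrite invr_gt0 | apply: bigmax_ge_id].
exists rho; split=> //.
  apply/bigmax_ltP; split=> [|u _]; first by rewrite invf_lt1// ltr1n.
  by rewrite ltr_pdivrMl// mulr1; apply/row_dist_lt2P.
apply: eta_TV_le (ltW rho_gt0) _ => // x y.
by rewrite -ler_pdivrMl//; apply: (le_bigmax _ _ (x, y)).
Qed.

(** * The Cesaro bounds *)

Lemma tces_TV_le_tmix (R : realType) (n : nat) (pi : 'rV[R]_n) (P : 'M[R]_n)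
    (eps : R) :
  transition_matrix P -> stationary pi P -> 0 < eps -> eps < 2^-1 ->
  (tces_TV pi eps P <= (1 / (eps * (1 - 2 * eps)))%:E * tmix_TV pi eps P)%E.
Proof.
move=> tP stP eps_gt0 eps_lt; have [dpi _] := stP.
have om_gt0 : 0 < 1 - 2 * eps by lra.
pose a := eps * (1 - 2 * eps); have a_gt0 : 0 < a by rewrite mulr_gt0.
(* Absorbs the loss from rounding to an integer: [T > t / a - 1] gives
   [a * T > t - a >= t - 1 + eps]. *)
have a_le : a <= 1 - eps by rewrite /a; nra.
rewrite /tmix_TV; set A := (X in first_time R X).
case: (first_timeP R A) => [[t [t_gt0 /bigmax_ltP[_ At] ->]]|->]; last first.
  by rewrite gt0_muley ?lte_fin ?divr_gt0// leey.
pose d s := TV pi (P ^+ s) (Pi_mx pi).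
have d_ge0 s : 0 <= d s by apply: TV_ge0.
have tPi := transition_Pi dpi.
have d_le1 s : d s <= 1 by apply: TV_le1 => //; apply: transition_exp.
have dt : d t < eps.
  apply: TV_lt => // x; under eq_bigr do rewrite mxE.
  exact: At.
(* Each row of [P ^+ t] is within [2 * eps] of [pi] in L1, so two rows are within twice that. *)
have rows x y : \sum_z `|(P ^+ t) x z - (P ^+ t) y z| <= 2 * (2 * eps).
  apply: (@le_trans _ _ (\sum_z (`|(P ^+ t) x z - pi 0 z|
                                 + `|(P ^+ t) y z - pi 0 z|))).
    by apply: ler_sum => z _; rewrite [X in _ <= _ + X]distrC ler_distD.
  by rewrite big_split/=; have := At x isT; have := At y isT; lra.
have tail T := @contracted_partial_sum _ (fun s => d s.+1) (2 * eps) t T.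
(* All terms are at most 1, and the last one, at the mixing time, is below [eps]. *)
have head : \sum_(s < t) d s.+1 < t%:R - 1 + eps.
  case: t t_gt0 dt {At rows tail} => // t _ dt.
  rewrite big_ord_recr/= -natr1 addrK ler_ltD//.
  apply: (@le_trans _ _ (\sum_(s < t) 1)); first by apply: ler_sum.
  by rewrite sumr_const card_ord.
rewrite -EFinM; apply: first_time_le => [|T T_gt0 T_gt].
  rewrite -/a mul1r mulrC ler_pdivlMr// mul1r.
  by apply: (@le_trans _ _ 1); [lra | rewrite ler1n].
have T_gt0' : 0 < T%:R :> R by rewrite ltr0n.
apply: le_lt_trans (TV_cesaro_le _ _ dpi T_gt0) _.
rewrite mulrC ltr_pdivrMr// -(ltr_pM2l om_gt0).
apply: le_lt_trans (tail T _ _) _ => // [s|].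
  by rewrite -addnS; apply: TV_exp_le.
apply: lt_trans head _.
rewrite mulrA (mulrC _ eps) -/a.
move: T_gt; rewrite -/a -(ltr_pM2l a_gt0) mulrBr mulrA mulrCA divff ?gt_eqF//.
by rewrite !mulr1 mul1r; lra.
Qed.

Theorem theorem4p5 (R : realType) (n : nat) (P : 'M[R]_n) (pi : 'rV[R]_n)
    (eps : R) (hP : transition_matrix P) (hirr : irreducible P)
    (hpi : stationary pi P) (heps : 0 < eps) :
  (eps < 2^-1 ->
    (tces_TV pi eps P <=
       (1 / (eps * (1 - 2 * eps)))%:E * tmix_TV pi eps P)%E)
  /\ ((exists theta : R,
         [/\ 0 < theta, theta < 1 & (eta_TV pi P <= theta%:E)%E])
      <-> scrambling P)
  /\ (forall theta : R, 0 < theta -> theta < 1 ->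
      (eta_TV pi P <= theta%:E)%E ->
      forall alpha : R, 0 < alpha -> alpha <> 1 ->
      ((Dalpha alpha pi P)%:E < +oo)%E ->
      [/\ (tces_TV pi eps P <=
             (1 / eps)%:E * avg_tmix_TV pi eps P + (1 / (1 - theta))%:E)%E,
          (tces_D alpha pi eps P <=
             (Dalpha alpha pi P / eps)%:E * avg_tmix_D alpha pi eps P
             + (1 / (1 - theta))%:E)%E
        & (tces_R alpha pi eps P <=
             ((1 + eps) / eps * Dalpha alpha pi P)%:E
               * avg_tmix_R alpha pi eps P
             + (1 / (1 - theta))%:E)%E]).
Proof.
have [dpi _] := hpi; have pi_gt0 := stationary_gt0 hP hirr hpi.
split; [exact: tces_TV_le_tmix | split; first exact: eta_TV_lt1P].
move=> theta th_gt0 th_lt1 eta_le alpha a_gt0 /eqP a_neq1 _.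
have rows := eta_TV_row_dist dpi (ltW th_gt0) eta_le.
have D_ge0 s := Dalpha_ge0 a_gt0 a_neq1 (transition_exp s hP) dpi pi_gt0.
(* The threshold is left free: [eps] serves for [Dalpha], and the one solving the Renyi condition
   for [Ralpha]. *)
have cesaro_D delta : 0 < delta ->
    (tces_D alpha pi delta P <= (Dalpha alpha pi P / delta)%:E
       * avg_tmix_D alpha pi delta P + (1 / (1 - theta))%:E)%E.
  move=> delta_gt0.
  apply: (cesaro_first_time (d := fun s => Dalpha alpha pi (P ^+ s))) => //.
  - move=> s; rewrite exprSr; apply: Dalpha_mulmx_le => //.
    exact: transition_exp.
  - by move=> T T_gt0; apply: Dalpha_cesaro_le.
split.
- apply: (cesaro_first_time (d := fun s => TV pi (P ^+ s) (Pi_mx pi))) => //.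
  + by move=> s; apply: TV_ge0.
  + by move=> s; rewrite -add1n; apply: TV_exp_le.
  + by apply: TV_le1 => //; exact: transition_Pi.
  + by move=> T T_gt0; apply: TV_cesaro_le.
- exact: cesaro_D.
have [delta [delta_ge RD]] := Ralpha_threshold a_gt0 a_neq1 heps dpi pi_gt0.
have eps1 : 0 < eps / (1 + eps) by rewrite divr_gt0// addr_gt0.
have delta_gt0 : 0 < delta by apply: lt_le_trans delta_ge.
have -> : tces_R alpha pi eps P = tces_D alpha pi delta P.
  by apply: first_time_ext => t t_gt0; apply/RD/transition_cesaro.
have -> : avg_tmix_R alpha pi eps P = avg_tmix_D alpha pi delta P.
  by apply: first_time_ext => t t_gt0; apply/RD/transition_exp.
(* It remains to replace [delta^-1] by its upper bound [(1 + eps) / eps]. *)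
apply: le_trans (cesaro_D _ delta_gt0) _.
rewrite leeD2r// lee_wpmul2r ?first_time_ge0// lee_fin mulrC.
rewrite ler_wpM2r ?(D_ge0 1%N)//.
by rewrite -[leRHS]invrK invf_div lef_pV2.
Qed.
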